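(* If $G$ is a group possessing an element $z$ of infinite order such that its centraliser $C(z)$ in $G$ contains a finitely generated subgroup which is not virtually nilpotent, then $G$ does not have Helfgott type growth.
   Context: An infinite group $G$ has Helfgott type growth if there exist $c,\delta>0$ such that every nonempty finite subset $A$ of $G$ for which the generated subgroup $\langle A\rangle$ is not virtually nilpotent satisfies $|A^3|\ge c|A|^{1+\delta}$, where $A^3=\{a_1a_2a_3 : a_1,a_2,a_3\in A\}$. *)

(* Defs.v *)
From mathcomp Require Import all_boot all_order all_algebra finmap.
From mathcomp Require Import all_classical all_reals all_analysis.

Set Implicit Arguments.
Unset Strict Implicit.
Unset Printing Implicit Defensive.

Local Open Scope classical_set_scope.
Local Open Scope group_scope.

(* The group theory of MathComp proper is about finite groups. Here groups are
   arbitrary [groupType]s, and their subgroups are classical sets. *)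
Definition is_subgroup (G : groupType) (H : set G) : Prop :=
  group_closed [in H].

Definition generated (G : groupType) (A : set G) : set G :=
  smallest (@is_subgroup G) A.

Definition finitely_generated (G : groupType) (H : set G) : Prop :=
  exists S : {fset G}, H = generated [set` S].

Definition centraliser (G : groupType) (z : G) : set G :=
  [set g | commute g z].

Definition infinite_order (G : groupType) (z : G) : Prop :=
  forall n : nat, (0 < n)%N -> z ^+ n <> 1.

(* Indexed from 0: [lower_central H n] is gamma_(n+1)(H). *)
Fixpoint lower_central (G : groupType) (H : set G) (n : nat) : set G :=
  if n is n'.+1 then
    generated [set g | exists x y,
      [/\ lower_central H n' x, H y & g = [~ x, y]]]
  else H.

Definition nilpotent_subgroup (G : groupType) (H : set G) : Prop :=
  is_subgroup H /\ exists n : nat, lower_central H n = [set 1].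

Definition left_coset (G : groupType) (x : G) (K : set G) : set G :=
  [set x * k | k in K].

Definition finite_index (G : groupType) (K H : set G) : Prop :=
  finite_set [set left_coset x K | x in H].

Definition virtually_nilpotent (G : groupType) (H : set G) : Prop :=
  exists K : set G, [/\ K `<=` H, nilpotent_subgroup K & finite_index K H].

Definition triple_product (G : groupType) (A : {fset G}) : {fset G} :=
  [fset x * c | x in [fset a * b | a in A, b in A], c in A]%fset.

(* Infiniteness of [G] is not part of the predicate. *)
Definition Helfgott_type_growth (R : realType) (G : groupType) : Prop :=
  exists c delta : R, [/\ (0 < c)%R, (0 < delta)%R &
    forall A : {fset G}, A != fset0 ->
      ~ virtually_nilpotent (generated [set` A]) ->
      (c * (#|` A|%:R `^ (1 + delta)) <= #|` triple_product A|%:R)%R].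

(* Main.v *)
Require Import Defs.
From mathcomp Require Import all_boot all_order all_algebra finmap.
From mathcomp Require Import all_classical all_reals all_analysis.
From mathcomp Require Import zify.

(** The powers of [z] supply a set that can be made arbitrarily long while its
    tripling stays linear, and a finite generating set [S] of the subgroup of
    [C(z)] keeps the generated group large. Put [1] into [S] and let
    [A_n = S * {z ^+ i | i < n}]. Since the elements of [S] commute with [z],
    the cube of [A_n] is contained in [S^3 * {z ^+ i | i < 3 n}], so it has at
    most [3 |S^3| n] elements ([triple_product_powers]), whereas [A_n] has at
    least [n] elements because [z] has infinite order
    ([card_initial_powers]). The group generated by [A_n] contains the given
    subgroup, and virtual nilpotence passes to subgroups
    ([virtually_nilpotentS]), so it is not virtually nilpotent. Helfgott type
    growth would then give [c * n `^ (1 + delta) <= 3 |S^3| n] for every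
    positive [n], with [|S^3|] independent of [n]; this fails for large [n]
    ([powR_superlinear]). *)

Set Implicit Arguments.
Unset Strict Implicit.
Unset Printing Implicit Defensive.

Import Order.TTheory GRing.Theory Num.Theory.

Local Open Scope classical_set_scope.

Lemma is_subgroupE (G : groupType) (H : set G) :
  is_subgroup H <-> H 1%g /\ forall x y, H x -> H y -> H (x / y)%g.
Proof.
split=> -[H1 HB]; split.
- by move: H1; rewrite inE.
- by move=> x y Hx Hy; move: (HB x y); rewrite !inE; apply.
- by rewrite inE.
- by move=> x y; rewrite !inE; apply: HB.
Qed.

Lemma generated_subgroup (G : groupType) (A : set G) :
  is_subgroup (generated A).
Proof.
apply/is_subgroupE; split=> [H [/is_subgroupE[H1 _] _] // | x y Ax Ay H [sH sAH]].
by have /is_subgroupE[_] := sH; apply; [apply: Ax | apply: Ay].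
Qed.

Lemma subset_generated (G : groupType) (A : set G) : A `<=` generated A.
Proof. exact: sub_gen_smallest. Qed.

Lemma generated_min (G : groupType) (A H : set G) :
  is_subgroup H -> A `<=` H -> generated A `<=` H.
Proof. exact: smallest_sub. Qed.

Lemma subgroupI (G : groupType) (H K : set G) :
  is_subgroup H -> is_subgroup K -> is_subgroup (H `&` K).
Proof.
move=> /is_subgroupE[H1 HB] /is_subgroupE[K1 KB]; apply/is_subgroupE.
by split=> // x y [Hx Kx] [Hy Ky]; split; [apply: HB | apply: KB].
Qed.

(** Each term of the series is the least subgroup containing certain
    commutators, and a smaller set has fewer of them. *)
Lemma lower_centralS (G : groupType) (H K : set G) (n : nat) :
  H `<=` K -> lower_central H n `<=` lower_central K n.
Proof.
move=> sHK; elim: n => //= n IHn.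
apply: generated_min; first exact: generated_subgroup.
move=> g [x [y [Hx Hy ->]]]; apply: subset_generated.
by exists x, y; split; [apply: IHn | apply: sHK |].
Qed.

Lemma lower_central1 (G : groupType) (H : set G) (n : nat) :
  is_subgroup H -> lower_central H n 1%g.
Proof.
move=> sH; suff /is_subgroupE[] : is_subgroup (lower_central H n) by [].
by case: n => // n; apply: generated_subgroup.
Qed.

Lemma nilpotent_subgroupS (G : groupType) (H K : set G) :
  is_subgroup H -> H `<=` K -> nilpotent_subgroup K -> nilpotent_subgroup H.
Proof.
move=> sH sHK [_ [n Kn1]]; split=> //; exists n; apply/seteqP; split.
  by rewrite -Kn1; apply: lower_centralS.
by move=> _ ->; apply: lower_central1.
Qed.

Lemma subgroupV (G : groupType) (H : set G) (x : G) :
  is_subgroup H -> H x -> H x^-1%g.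
Proof.
by move=> /is_subgroupE[H1 HB] Hx; rewrite -[x^-1%g]mul1g; apply: HB.
Qed.

Lemma subgroupM (G : groupType) (H : set G) (x y : G) :
  is_subgroup H -> H x -> H y -> H (x * y)%g.
Proof.
move=> sH Hx Hy; have /is_subgroupE[_ HB] := sH.
by rewrite -[y]invgK; apply: HB => //; apply: subgroupV.
Qed.

(** If [x * k] and [x] lie in [H] then so does [k]: cosets of [H `&` K] in [H]
    are traces on [H] of cosets of [K]. *)
Lemma left_cosetI (G : groupType) (x : G) (H K : set G) :
  is_subgroup H -> H x -> left_coset x (H `&` K) = H `&` left_coset x K.
Proof.
move=> sH Hx; apply/seteqP; split=> [_ [k [Hk Kk] <-] | y [+ [k Kk def_y]]].
  by split; [apply: subgroupM | exists k].
rewrite -def_y => Hxk; exists k => //; split=> //.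
by rewrite -(mulKg x k); apply: subgroupM => //; apply: subgroupV.
Qed.

(** By [left_cosetI], taking traces on [H] maps the cosets of [K] in [L] onto
    a family that includes all the cosets of [H `&` K] in [H]. *)
Lemma finite_indexS (G : groupType) (H K L : set G) :
  is_subgroup H -> H `<=` L -> finite_index K L -> finite_index (H `&` K) H.
Proof.
move=> sH sHL /(finite_image (fun C => H `&` C)); apply: sub_finite_set.
move=> _ [x Hx <-]; exists (left_coset x K); last by rewrite left_cosetI.
by exists x => //; apply: sHL.
Qed.

(** If [K] is a nilpotent subgroup of finite index in [L], its trace [H `&` K]
    plays the same role for [H]. *)
Lemma virtually_nilpotentS (G : groupType) (H L : set G) :
  is_subgroup H -> H `<=` L -> virtually_nilpotent L -> virtually_nilpotent H.
Proof.
move=> sH sHL [K [sKL nK iKL]]; exists (H `&` K); split.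
- exact: subIsetl.
- have [sK _] := nK.
  by apply: nilpotent_subgroupS nK; [apply: subgroupI | apply: subIsetr].
- exact: finite_indexS iKL.
Qed.

Definition product_set (G : groupType) (A B : {fset G}) : {fset G} :=
  [fset a * b | a in A, b in B]%g%fset.

Definition initial_powers (G : groupType) (z : G) (n : nat) : {fset G} :=
  [fset z ^+ val i | i in 'I_n]%g%fset.

Lemma product_setP (G : groupType) (A B : {fset G}) (g : G) :
  reflect (exists a b, [/\ a \in A, b \in B & g = a * b]%g)
          (g \in product_set A B).
Proof.
apply: (iffP (imfset2P _ _ _ _ _)) => [[a Aa [b Bb ->]] | [a [b [Aa Bb ->]]]].
  by exists a, b.
by exists a => //; exists b.
Qed.

Lemma card_product_set (G : groupType) (A B : {fset G}) :
  (#|` product_set A B| <= #|` A| * #|` B|)%N.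
Proof.
rewrite -(size_allpairs (fun a b => a * b)%g); apply: uniq_leq_size.
  exact: fset_uniq.
by move=> _ /product_setP[a [b [Aa Bb ->]]]; apply: allpairs_f.
Qed.

Lemma initial_powersP (G : groupType) (z : G) (n : nat) (g : G) :
  reflect (exists2 i, (i < n)%N & g = z ^+ i)%g (g \in initial_powers z n).
Proof.
apply: (iffP (imfsetP _ _ _ _)) => [[i _ ->] | [i ltin ->]].
  by exists (val i); first exact: ltn_ord.
by exists (Ordinal ltin).
Qed.

(** A coincidence [z ^+ i = z ^+ j] with [i < j] would make [z ^+ (j - i)]
    trivial. *)
Lemma card_initial_powers (G : groupType) (z : G) (n : nat) :
  infinite_order z -> #|` initial_powers z n| = n.
Proof.
move=> hz; rewrite card_in_imfset /=; first by rewrite -cardE card_ord.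
move=> i j _ _ zij; apply/val_inj.
wlog ltij : i j zij / (i < j)%N.
  by move=> IH; case: (ltngtP i j) => // h; [|symmetry]; apply: IH.
case: (hz (j - i)%N); first by rewrite subn_gt0.
by rewrite expgnFr ?(ltnW ltij)// -zij mulgV.
Qed.

(** Elements of [S] commute with powers of [z], so the powers can be collected
    on the right; the sum of three exponents below [n] is below [3 * n]. *)
Lemma triple_product_powers (G : groupType) (z : G) (S : {fset G}) (n : nat) :
    [set` S] `<=` centraliser z ->
  (triple_product (product_set S (initial_powers z n))
     `<=` product_set (triple_product S) (initial_powers z (3 * n)))%fset.
Proof.
move=> cSz; have comX (s : G) i : s \in S -> commute (z ^+ i)%g s.
  by move=> Ss; apply/commute_sym/commuteX; apply: cSz.
apply/fsubsetP => _ /product_setP[_ [_ [/product_setP[_ [_ [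
  /product_setP[a [_ [Sa /initial_powersP[i ltin ->] ->]]]
  /product_setP[b [_ [Sb /initial_powersP[j ltjn ->] ->]]] ->]]]
  /product_setP[c [_ [Sc /initial_powersP[k ltkn ->] ->]]] ->]]].
apply/product_setP; exists (a * b * c)%g, (z ^+ (i + j + k))%g; split.
- by apply/product_setP; exists (a * b)%g, c; split=> //;
    apply/product_setP; exists a, b.
- by apply/initial_powersP; exists (i + j + k)%N => //; lia.
rewrite !expgnDr !mulgA.
rewrite -(mulgA a) (comX b i Sb) mulgA -(mulgA _ (z ^+ j)%g c) (comX c j Sc).
by rewrite !mulgA -(mulgA _ _ c) (comX c i Sc) !mulgA.
Qed.

(** Dividing by [c * n], the claim is that [n `^ delta] exceeds [M / c], which
    holds as soon as [n] exceeds [(`|M| / c) `^ delta^-1]. *)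
Lemma powR_superlinear (R : realType) (c delta M : R) :
    (0 < c)%R -> (0 < delta)%R ->
  exists2 n : nat, (0 < n)%N & (M * n%:R < c * n%:R `^ (1 + delta))%R.
Proof.
(* The absolute value makes the base of the real power nonnegative. *)
move=> c0 d0; pose x := (`|M| / c)%R.
have x0 : (0 <= x)%R by rewrite divr_ge0 // ltW.
pose y := (x `^ delta^-1)%R; pose n := (Num.truncn y).+1.
have yn : (y < n%:R)%R by exact: truncnS_gt.
exists n => //; have n0 : (0 < n%:R :> R)%R by rewrite ltr0n.
have xn : (x < n%:R `^ delta)%R.
  have -> : x = (y `^ delta)%R by rewrite -powRrM mulVf ?lt0r_neq0// powRr1.
  by apply: gt0_ltr_powR; rewrite ?nnegrE ?powR_ge0 ?ltW.
rewrite powRD; last by rewrite lt0r_neq0 ?implybT.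
rewrite powRr1 ?ltW// mulrCA mulrC ltr_pM2l//.
by apply: le_lt_trans (ler_norm M) _; rewrite mulrC -ltr_pdivrMr.
Qed.

Theorem proposition4p2 (R : realType) (G : groupType) (z : G)
    (hz : infinite_order z)
    (hC : exists H : set G, [/\ is_subgroup H, H `<=` centraliser z,
            finitely_generated H & ~ virtually_nilpotent H]) :
  ~ Helfgott_type_growth R G.
Proof.
case: hC => H [sH cHz [S0 HS0] nvH] [c [delta [c0 d0 growth]]].
pose S := (1%g |` S0)%fset.
have SH : [set` S] `<=` H.
  have /is_subgroupE[H1 _] := sH.
  move=> s /=; rewrite in_fset1U => /orP[/eqP-> // | S0s].
  by rewrite HS0; apply: subset_generated.
(* At this [n] the linear upper bound on the cube of [A] is already smaller
   than the lower bound that growth gives. *)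
have [n n0] := powR_superlinear ((3 * #|` triple_product S|)%:R)%R c0 d0.
apply/negP; rewrite -leNgt.
pose A := product_set S (initial_powers z n).
have ZA : (initial_powers z n `<=` A)%fset.
  apply/fsubsetP => g Zg; apply/product_setP; exists 1%g, g.
  by rewrite mul1g fset1U1.
have SA : [set` S0] `<=` generated [set` A].
  move=> s /= S0s; apply: subset_generated => /=; apply/product_setP.
  exists s, 1%g; rewrite mulg1 fset1Ur//; split=> //.
  by apply/initial_powersP; exists 0%N.
have nA : (n <= #|` A|)%N.
  by rewrite -{1}(card_initial_powers n hz); apply: fsubset_leq_card.
have A3 : (#|` triple_product A| <= 3 * #|` triple_product S| * n)%N.
  have sub := triple_product_powers n (subset_trans SH cHz).
  apply: leq_trans (fsubset_leq_card sub) (leq_trans (card_product_set _ _) _).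
  by rewrite card_initial_powers// mulnCA mulnA.
have A0 : A != fset0 by rewrite -cardfs_gt0 (leq_trans n0).
have nvA : ~ virtually_nilpotent (generated [set` A]).
  apply: contra_not nvH; apply: virtually_nilpotentS => //.
  by rewrite HS0; apply: generated_min => //; apply: generated_subgroup.
apply: (@le_trans _ _ (c * #|` A|%:R `^ (1 + delta))%R).
  rewrite ler_pM2l//; apply: ge0_ler_powR; rewrite ?nnegrE ?ler0n ?ler_nat//.
  by rewrite addr_ge0// ltW.
by apply: le_trans (growth A A0 nvA) _; rewrite -natrM ler_nat.
Qed.
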